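(* Let $0<p\leq 1$ be a fixed constant and let $G\sim G(n,p)$, with $n$ sufficiently large. Then with high probability there exists a partition $V(G)=V_1\cup\cdots\cup V_t$ into disjoint subsets such that for all $1\leq i\leq t$: (i) $G[V_i]$ is a clique; (ii) $|V_i|=\Theta(\ln^{1/3} n)$; (iii) $|V_i|$ is even for all $1\leq i\leq t-1$.
   Context: $G(n,p)$ is the binomial random graph on $n$ vertices with each edge present independently with probability $p$. ''With high probability'' means with probability tending to $1$ as $n\to\infty$. $G[S]$ denotes the subgraph induced on $S$. *)

(* Defs.v *)
From HB Require Import structures.
From mathcomp Require Import all_boot all_order all_algebra.
From mathcomp Require Import all_classical all_reals all_analysis.
Set Implicit Arguments. Unset Strict Implicit. Unset Printing Implicit Defensive.
Import Order.TTheory GRing.Theory Num.Theory.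
Local Open Scope ring_scope.

(* A simple graph on vertex set 'I_n is its edge set: a set of 2-element
   subsets of 'I_n. *)
Definition pairs (n : nat) : {set {set 'I_n}} := [set e : {set 'I_n} | #|e| == 2%N].

Definition gnp_weight (R : realType) (n : nat) (p : R) (E : {set {set 'I_n}}) : R :=
  \prod_(e in pairs n) (if e \in E then p else 1 - p).

Definition gnp_prob (R : realType) (n : nat) (p : R) (P : pred {set {set 'I_n}}) : R :=
  \sum_(E in powerset (pairs n) | P E) gnp_weight p E.

Definition is_clique (n : nat) (E : {set {set 'I_n}}) (V : {set 'I_n}) : bool :=
  [forall x in V, forall y in V, (x != y) ==> ([set x; y] \in E)].

Definition good_partition (R : realType) (c1 c2 : R) (n : nat)
    (E : {set {set 'I_n}}) : Prop :=
  exists s : seq {set 'I_n},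
    [/\ uniq s, finset.partition [set X in s] [set: 'I_n],
        (forall V, V \in s -> is_clique E V),
        (forall V, V \in s ->
           c1 * (ln (n%:R : R)) `^ (3^-1) <= (#|V|%:R : R)
           /\ (#|V|%:R : R) <= c2 * (ln (n%:R : R)) `^ (3^-1)) &
        (forall i, (i.+1 < size s)%N -> ~~ odd #|nth (finset.set0 : {set 'I_n}) s i|)].

(* Main.v *)
(* Write x = (ln n)^(1/3) and let K be an even number with x <= K <= 2x. With
   high probability two properties hold: every set S of at least exp(3x^3/4)
   vertices spans more than a quarter of the expected number of edges, and any
   two vertices have more than p^2(n-2)/4 common neighbours. Both follow from
   an exponential-moment lower tail bound; 2^n = o(exp(|S|^2)) makes the union
   bound over all S affordable.

   The first property gives each large S a vertex adjacent to a constant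
   fraction of S; iterating K times, where c^K = n^(-o(1)), produces a K-clique
   in every set of size n^(1-eps). Greedily removing K-cliques therefore leaves
   a set L of size o(n/K). The vertices of L are absorbed in pairs {u, v}: by
   averaging, many of the K-cliques C contain a linear number of common
   neighbours of u and v, so C can be cut into A, B and an even rest with
   |A| = |B| = h odd and u + A, v + B cliques. If n is odd, the last remaining
   vertex takes an even part of such a C, which gives the only odd block. *)
Require Import Defs.
From mathcomp Require Import all_boot all_order all_algebra.
From mathcomp Require Import ring lra zify.
From mathcomp Require Import reals sequences exp.
Import Order.TTheory GRing.Theory Num.Theory.
Local Open Scope ring_scope.

(** Distributivity is available for a product over the whole type. Outside [D] the factor is padded
    to [0 + 1], so subsets not contained in [D] contribute zero. *)
Lemma prodrD_powerset (R : comNzRingType) (T : finType) (D : {set T})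
    (F G : T -> R) :
  \prod_(i in D) (F i + G i) =
  \sum_(J in powerset D) \prod_(i in D) (if i \in J then F i else G i).
Proof.
rewrite big_mkcond /=.
rewrite (eq_bigr (fun i => (if i \in D then F i else 0) +
                           (if i \in D then G i else 1))); last first.
  by move=> i _; case: ifP => //; rewrite add0r.
rewrite bigA_distr (bigID (fun J : {set T} => J \subset D)) /=.
rewrite [X in _ + X]big1 ?addr0 => [|J /subsetPn[x xJ xD]]; last first.
  by rewrite (bigD1 x) //= xJ (negbTE xD) mul0r.
apply: eq_big => [J|J sJD]; first by rewrite powersetE.
rewrite [RHS]big_mkcond /=; apply: eq_bigr => i _.
case: (boolP (i \in D)) => // iD.
by rewrite ifF //; apply: contraNF iD => /(subsetP sJD).
Qed.

(** * Probabilities in the binomial random graph: union bounds and a lower tail *)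

Section BinomialRandomGraph.
Variables (R : realType) (n : nat) (p : R).
Hypotheses (p_ge0 : 0 <= p) (p_le1 : p <= 1).

Implicit Types (E A : {set {set 'I_n}}) (P Q : pred {set {set 'I_n}}).

Lemma gnp_weight_ge0 E : 0 <= gnp_weight p E.
Proof. by apply: prodr_ge0 => e _; case: ifP => _ //; rewrite subr_ge0. Qed.

(** In the product over all pairs, write each factor as [p + (1 - p)] off [A] and [p + 0] on [A].
    Expanding it leaves exactly the weights of the [E] that contain [A]. *)
Lemma gnp_prob_subset A :
  A \subset pairs n -> gnp_prob p (fun E => A \subset E) = p ^+ #|A|.
Proof.
move=> sAD.
transitivity (\prod_(e in pairs n) (p + (if e \in A then 0 else 1 - p))).
  rewrite prodrD_powerset /gnp_prob [RHS](bigID (fun E => A \subset E)) /=.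
  rewrite [X in _ = _ + X]big1 ?addr0 => [|E /andP[_ /subsetPn[x xA xE]]].
    apply: eq_bigr => E /andP[_ sAE]; apply: eq_bigr => e _.
    case: ifP => // eE; rewrite ifF //.
    by apply: contraFF eE => /(subsetP sAE).
  by rewrite (bigD1 x) ?(subsetP sAD) //= (negbTE xE) xA mul0r.
rewrite (bigID (mem A)) /= [X in _ * X]big1 ?mulr1 => [|e /andP[_ /negbTE->]].
  rewrite (eq_bigr (fun=> p)) => [|e /andP[_ ->]]; last by rewrite addr0.
  rewrite (eq_bigl (mem A)) ?prodr_const // => e /=.
  by case: (boolP (e \in A)) => [/(subsetP sAD)->|_]; rewrite ?andbF.
by rewrite addrC subrK.
Qed.

Lemma gnp_prob_predT : gnp_prob p (@predT {set {set 'I_n}}) = 1.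
Proof.
rewrite -[RHS](expr0 p) -(cards0 {set 'I_n}) -gnp_prob_subset ?sub0set //.
by apply: eq_bigl => E; rewrite sub0set.
Qed.

Lemma gnp_probC P : gnp_prob p P = 1 - gnp_prob p (fun E => ~~ P E).
Proof.
apply/eqP; rewrite eq_sym subr_eq eq_sym -gnp_prob_predT /gnp_prob; apply/eqP.
by under [RHS]eq_bigl do rewrite andbT; rewrite [RHS](bigID P).
Qed.

Lemma le_gnp_prob P Q : (forall E, P E -> Q E) -> gnp_prob p P <= gnp_prob p Q.
Proof.
move=> PQ; rewrite /gnp_prob [leRHS](bigID P) /= -[leLHS]addr0.
rewrite lerD ?sumr_ge0 // => [|E _]; last exact: gnp_weight_ge0.
rewrite le_eqVlt; apply/orP; left; apply/eqP/eq_bigl => E.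
by case: (boolP (P E)) => [/PQ->|]; rewrite ?andbF ?andbT.
Qed.

Lemma gnp_prob_or P Q :
  gnp_prob p (fun E => P E || Q E) <= gnp_prob p P + gnp_prob p Q.
Proof.
rewrite /gnp_prob !big_mkcondr -big_split /=.
apply: ler_sum => E _; have w0 := gnp_weight_ge0 E.
by case: (P E); case: (Q E); rewrite /= ?addr0 ?add0r // lerDl.
Qed.

Lemma gnp_prob_exists (I : finType) (r : pred I)
    (P : I -> pred {set {set 'I_n}}) :
  gnp_prob p (fun E => [exists i in r, P i E]) <=
  \sum_(i in r) gnp_prob p (P i).
Proof.
rewrite /gnp_prob big_mkcondr.
under [leRHS]eq_bigr do rewrite big_mkcondr /=.
rewrite exchange_big /=; apply: ler_sum => E _; have w0 := gnp_weight_ge0 E.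
case: existsP => [[i /andP[ri PiE]]|_].
  rewrite (bigD1 i) //= PiE lerDl; apply: sumr_ge0 => j _.
  by case: ifP.
by apply: sumr_ge0 => j _; case: ifP.
Qed.

(* Expanding both products over subfamilies [J] reduces this to
   [gnp_prob_subset] applied to [cover J]. *)
Lemma gnp_expect_prod (B : {set {set {set 'I_n}}}) (c : R) :
  trivIset B -> (forall b, b \in B -> b \subset pairs n) ->
  \sum_(E in powerset (pairs n))
     gnp_weight p E * \prod_(b in B) (1 - c * (b \subset E)%:R) =
  \prod_(b in B) (1 - c * p ^+ #|b|).
Proof.
move=> tB sB.
have expand (f : {set {set 'I_n}} -> R) : \prod_(b in B) (1 - c * f b) =
    \sum_(J in powerset B) (- c) ^+ #|J| * \prod_(b in J) f b.
  under eq_bigr do rewrite addrC.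
  rewrite prodrD_powerset; apply: eq_bigr => J; rewrite powersetE => sJB.
  rewrite (bigID (mem J)) /= [X in _ * X]big1 ?mulr1 => [|b /andP[_ /negbTE->]//].
  rewrite -prodr_const -big_split /=.
  apply: eq_big => [b|b /andP[_ ->]]; last by rewrite mulNr.
  by case: (boolP (b \in J)) => [/(subsetP sJB)->|_]; rewrite ?andbF.
rewrite expand; under eq_bigr do rewrite expand big_distrr /=.
rewrite exchange_big /=; apply: eq_bigr => J; rewrite powersetE => sJB.
under eq_bigr do rewrite mulrCA.
rewrite -big_distrr /=; congr (_ * _).
have /eqP cJ : trivIset J by apply: trivIsetS tB.
rewrite prodrXr cJ -gnp_prob_subset; last first.
  by apply/bigcupsP => b bJ; apply: sB; apply: (subsetP sJB).
rewrite /gnp_prob big_mkcondr; apply: eq_bigr => E _.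
case: (boolP (cover J \subset E)) => [/bigcupsP sJE|].
  by rewrite big1 ?mulr1 // => b /sJE->.
move=> /subsetPn[x /bigcupP[b bJ xb] xE]; rewrite (bigD1 b) //=.
rewrite (_ : b \subset E = false) ?mul0r ?mulr0 //.
by apply: contraNF xE => /subsetP; apply.
Qed.

(** Let X count the [b] contained in [E], with [q = p ^+ k] and [N = #|B|]. Disjointness gives
    E[exp(-X)] = (1 - cq)^N with c = 1 - 1/e >= 1/2, which is at most exp(-qN/2). Markov's
    inequality costs a factor exp(qN/4). *)
Lemma gnp_lower_tail (B : {set {set {set 'I_n}}}) (k : nat) :
  trivIset B -> (forall b, b \in B -> b \subset pairs n) ->
  (forall b, b \in B -> #|b| = k) ->
  gnp_prob p
    (fun E => #|[set b in B | b \subset E]|%:R <= p ^+ k * #|B|%:R / 4) <=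
  expR (- (p ^+ k * #|B|%:R / 4)).
Proof.
move=> tB sB cB; set N : R := #|B|%:R; set q := p ^+ k.
have q_ge0 : 0 <= q by rewrite exprn_ge0.
have N_ge0 : 0 <= N by rewrite ler0n.
pose c : R := 1 - expR (- 1).
have c_ge : 2^-1 <= c.
  have e2 : 2 <= expR 1 :> R by have := expR_ge1Dx (1 : R); lra.
  have e0 : 0 < expR 1 :> R by exact: expR_gt0.
  have : (expR 1)^-1 <= 2^-1 :> R by rewrite lef_pV2 ?posrE.
  by rewrite /c expRN; lra.
(* An indicator takes only the values 0 and 1, so its exponential is affine in it. This is the form
   that [gnp_expect_prod] evaluates. *)
have expX E : expR (- #|[set b in B | b \subset E]|%:R) =
    \prod_(b in B) (1 - c * (b \subset E)%:R) :> R.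
  rewrite -mulrN1 expRM_natl -prodr_const big_mkcond [RHS]big_mkcond /=.
  apply: eq_bigr => b _; rewrite inE; case: (b \in B) => //=.
  by case: (b \subset E); rewrite /c /= ?mulr1 ?mulr0 ?subr0 // opprB addrC subrK.
apply: (@le_trans _ _ (expR (q * N / 4) * \sum_(E in powerset (pairs n))
   gnp_weight p E * \prod_(b in B) (1 - c * (b \subset E)%:R))).
  rewrite big_distrr /gnp_prob big_mkcondr /=; apply: ler_sum => E _.
  have w0 := gnp_weight_ge0 E; rewrite mulrCA -expX -expRD.
  case: ifP => [XE|_]; last by rewrite mulr_ge0 ?expR_ge0.
  by rewrite ler_peMr // -[leLHS]expR0 ler_expR subr_ge0.
rewrite gnp_expect_prod // (eq_bigr (fun=> 1 - c * q)) => [|b /cB->//].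
rewrite prodr_const.
have -> : - (q * N / 4) = q * N / 4 + - (q / 2) * N by lra.
rewrite expRD ler_pM2l ?expR_gt0 // expRM_natr lerXn2r ?nnegrE ?expR_ge0 //.
  have q1 : q <= 1 by rewrite exprn_ile1.
  have c1 : c <= 1 by rewrite /c gerBl expR_ge0.
  rewrite subr_ge0 mulr_ile1 //; lra.
apply: le_trans (expR_ge1Dx _); rewrite lerD2l lerN2.
by rewrite [leRHS]mulrC ler_wpM2l.
Qed.

End BinomialRandomGraph.

Lemma exists_subset_card (T : finType) (A : {set T}) (k : nat) :
  (k <= #|A|)%N -> exists2 B : {set T}, B \subset A & #|B| = k.
Proof.
move=> kA; have : (0 < #|[set B : {set T} | B \subset A & #|B| == k]|)%N.
  by rewrite cards_draws bin_gt0.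
by case/card_gt0P=> B; rewrite inE => /andP[sBA /eqP]; exists B.
Qed.

Lemma leq_card_bigcup (I T : finType) (S : {set I}) (F : I -> {set T}) :
  (#|\bigcup_(i in S) F i| <= \sum_(i in S) #|F i|)%N.
Proof.
elim/big_rec2: _ => [|i k A _ leA]; first by rewrite cards0.
by apply: leq_trans (leq_card_setU _ _) _; rewrite leq_add2l.
Qed.

(** * Cliques in a fixed graph: greedy construction and packing *)

Section Graphs.
Variables (n : nat) (E : {set {set 'I_n}}).

Definition nbhd (v : 'I_n) : {set 'I_n} :=
  [set w | (w != v) && ([set v; w] \in E)].

(** [E] is an arbitrary family of vertex sets here, so the size of an edge is imposed explicitly,
    just as [nbhd] excludes [v] itself. *)
Definition edges_in (S : {set 'I_n}) : {set {set 'I_n}} :=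
  [set e in E | (e \subset S) && (#|e| == 2)].

(** Each edge is charged to one of its endpoints. The factor 2 of the handshake identity is given
    up. *)
Lemma card_edges_in_le (S : {set 'I_n}) :
  (#|edges_in S| <= \sum_(v in S) #|nbhd v :&: S|)%N.
Proof.
have : edges_in S \subset
    \bigcup_(v in S) [set [set v; w] | w in nbhd v :&: S].
  apply/subsetP => e; rewrite inE => /andP[eE /andP[sE /cards2P[x [y [nxy e_xy]]]]].
  subst e; move: sE; rewrite subUset !sub1set => /andP[xS yS].
  apply/bigcupP; exists x => //; apply/imsetP; exists y => //.
  by rewrite !inE eq_sym nxy eE yS.
move=> sub; apply: leq_trans (subset_leq_card sub) _.
apply: leq_trans (leq_card_bigcup _ _ _ _) _.
by apply: leq_sum => v _; apply: leq_imset_card.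
Qed.

Lemma is_cliqueS (A B : {set 'I_n}) :
  A \subset B -> is_clique E B -> is_clique E A.
Proof.
move=> sAB /forall_inP cB; apply/forall_inP => x xA; apply/forall_inP => y yA.
by have /forall_inP := cB x (subsetP sAB _ xA); apply; apply: (subsetP sAB).
Qed.

Lemma is_cliqueU1 (v : 'I_n) (A : {set 'I_n}) :
  is_clique E A -> A \subset nbhd v -> is_clique E (v |: A).
Proof.
move=> /forall_inP cA /subsetP sAN.
have vN y : y \in A -> [set v; y] \in E.
  by move/sAN; rewrite inE => /andP[].
apply/forall_inP => x /setU1P[->|xA]; apply/forall_inP => y /setU1P[->|yA].
- by rewrite eqxx.
- by rewrite vN ?implybT.
- by rewrite setUC vN ?implybT.
- by have /forall_inP := cA x xA; apply.
Qed.

(** Pick a vertex of large degree in [S] and recurse inside its neighbourhood. Each step shrinks the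
    set by a factor no worse than [a], so the set still has at least [s] vertices at every
    choice. *)
Lemma clique_of_dense (R : realFieldType) (a s : R) :
  0 <= a -> a <= 1 ->
  (forall S : {set 'I_n}, s <= #|S|%:R ->
     exists2 v, v \in S & a * #|S|%:R <= #|nbhd v :&: S|%:R) ->
  forall (j : nat) (S : {set 'I_n}), s <= a ^+ j * #|S|%:R ->
  exists2 Q : {set 'I_n}, Q \subset S & is_clique E Q /\ #|Q| = j.
Proof.
move=> a0 a1 dense; elim=> [|j IHj] S sS.
  exists set0; rewrite ?sub0set ?cards0 //; split=> //.
  by apply/forall_inP => x; rewrite inE.
have [|v vS dv] := dense S.
  apply: le_trans sS _; rewrite ler_piMl ?ler0n // exprn_ile1 //.
have [|Q sQ [cQ QE]] := IHj (nbhd v :&: S).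
  apply: le_trans sS _; rewrite exprSr -mulrA ler_wpM2l ?exprn_ge0 //.
move: sQ; rewrite subsetI => /andP[sQN sQS].
exists (v |: Q); first by rewrite subUset sub1set vS.
split; first exact: is_cliqueU1.
rewrite cardsU1 QE (_ : v \notin Q) //.
by apply/negP => /(subsetP sQN); rewrite inE eqxx.
Qed.

Local Open Scope nat_scope.

Lemma clique_packing (K m : nat) :
  0 < K ->
  (forall S : {set 'I_n}, m <= #|S| ->
     exists2 Q : {set 'I_n}, Q \subset S & is_clique E Q /\ #|Q| = K) ->
  exists (P : {set {set 'I_n}}) (L : {set 'I_n}),
    [/\ partition P (~: L), #|L| < m &
        forall C, C \in P -> is_clique E C /\ #|C| = K].
Proof.
move=> K0 cliques.
(* Induction on a bound for the uncovered set [L], starting from the empty packing; each removed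
   clique strictly shrinks [L]. *)
suff step k : forall (P : {set {set 'I_n}}) (L : {set 'I_n}),
    partition P (~: L) -> #|L| <= k ->
    (forall C, C \in P -> is_clique E C /\ #|C| = K) ->
  exists (P : {set {set 'I_n}}) (L : {set 'I_n}),
    [/\ partition P (~: L), #|L| < m &
        forall C, C \in P -> is_clique E C /\ #|C| = K].
  apply: (step #|[set: 'I_n]| set0 setT) => // [|C]; last by rewrite inE.
  by rewrite setCT partition_set0.
elim: k => [|k IHk] P L partP Lk cP.
  have [mL|Lm] := leqP m #|L|; last by exists P, L.
  have [Q /subset_leq_card] := cliques _ mL.
  by move=> + [_ QK]; rewrite QK; lia.
have [mL|Lm] := leqP m #|L|; last by exists P, L.
have [Q sQL [cQ QK]] := cliques _ mL.
apply: (IHk (Q |: P) (L :\: Q)).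
- have -> : ~: (L :\: Q) = Q :|: ~: L by rewrite setCD setUC.
  apply: partitionU1 => //; first by rewrite -card_gt0 QK.
  by rewrite disjoints_subset setCK.
- by rewrite cardsD (setIidPr sQL) QK; lia.
- by move=> C /setU1P[->|/cP].
Qed.

(** Count [W]: at most [#|L|] of its vertices lie in [L], a clique of the family [G] holds at most
    [K], and each of the other cliques, of which there are at most [n / K], holds at most [l]. Fewer
    than [#|L|] cliques in [G] would make [W] too small. *)
Lemma partition_average (K l : nat) (P : {set {set 'I_n}})
    (L W : {set 'I_n}) :
  partition P (~: L) -> (forall C, C \in P -> #|C| = K) ->
  #|L| * K.+1 * K + l * n < K * #|W| ->
  #|L| <= #|[set C in P | l <= #|W :&: C|]|.
Proof.
move=> partP cP big; set G := [set C in P | _].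
have PK : #|P| * K <= n.
  rewrite -sum_nat_const -(eq_bigr _ cP) -(card_partition partP).
  by rewrite -[n in _ <= n]card_ord max_card.
have WE : #|W| <= #|L| + \sum_(C in P) #|W :&: C|.
  rewrite -(cardsID L W) leq_add ?subset_leq_card ?subsetIr //.
  apply: leq_trans (leq_card_bigcup _ _ _ _); apply: subset_leq_card.
  apply/subsetP => x /setDP[xW xL].
  have : x \in cover P by rewrite (cover_partition partP) inE.
  by case/bigcupP=> C CP xC; apply/bigcupP; exists C; rewrite // inE xW.
have sumE : \sum_(C in P) #|W :&: C| <= #|G| * K + #|P| * l.
  rewrite (bigID (fun C => C \in G)) /= leq_add //.
    rewrite (eq_bigl (mem G)); last first.
      by move=> C; rewrite !inE; case: (C \in P).
    rewrite -sum_nat_const; apply: leq_sum => C CG; move: (CG : C \in G).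
    rewrite inE => /andP[CP _]; rewrite -(cP C CP).
    by rewrite subset_leq_card ?subsetIr.
  apply: (@leq_trans (\sum_(C in P | C \notin G) l)).
    apply: leq_sum => C /andP[CP]; rewrite inE CP /= -ltnNge; exact: ltnW.
  by rewrite -sum_nat_const [leqRHS](bigID (fun C => C \in G)) /= leq_addl.
rewrite leqNgt; apply/negP => GL; nia.
Qed.

(** * Absorption of the leftover vertices *)

Lemma block_sizes (h K : nat) : odd h -> ~~ odd K -> 4 * h <= K ->
  [/\ 0 < K - h.*2, h <= K - h.*2, ~~ odd (K - h.*2), h.*2 < K & h <= h.*2.+1].
Proof. by move=> odd_h even_K hK; split; lia. Qed.

Definition even_block (h K : nat) (V : {set 'I_n}) : bool :=
  [&& is_clique E V, h <= #|V|, #|V| <= K & ~~ odd #|V|].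

(** Exactly [K] vertices are required so that cutting out [h.*2] of them leaves an even block of
    known size [K - h.*2]; blocks already cut are smaller and are not reused. *)
Definition common_blocks (h K : nat) (P : {set {set 'I_n}}) (u v : 'I_n) :=
  [set C in P | (#|C| == K) && (h.*2 <= #|nbhd u :&: nbhd v :&: C|)].

(** Absorbing a pair of vertices uses up one block. The bound on common blocks therefore persists:
    [#|L|] drops by two, the number of blocks available to any pair by at most one. *)
Lemma absorb_leftover (h K : nat) :
  1 < n -> odd h -> ~~ odd K -> 4 * h <= K ->
  forall (k : nat) (P : {set {set 'I_n}}) (L : {set 'I_n}),
  #|L| <= k ->
  partition P (~: L) -> (forall V, V \in P -> even_block h K V) ->
  (forall u v, u != v -> #|L| <= #|common_blocks h K P u v|) ->
  exists s : seq {set 'I_n},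
    [/\ uniq s, partition [set X in s] [set: 'I_n],
        forall V, V \in s -> [/\ is_clique E V, h <= #|V| & #|V| <= K] &
        forall i, i.+1 < size s -> ~~ odd #|nth set0 s i|].
Proof.
move=> n1 odd_h even_K hK.
have [Kh_gt0 le_h_Kh even_Kh h2_ltK le_h_h2] := block_sizes h K odd_h even_K hK.
have h_ltK : h < K by apply: leq_ltn_trans h2_ltK; rewrite -addnn leq_addr.
elim=> [|k IHk] P L Lk partP blockP common.
  have L0 : L = set0 by apply/eqP; rewrite -cards_eq0 -leqn0.
  exists (enum P); split; first exact: enum_uniq.
  - have -> : [set X in enum P] = P by apply/setP => X; rewrite inE mem_enum.
    by rewrite -setC0 -L0.
  - by move=> V; rewrite mem_enum => /blockP /and4P[].
  - move=> i /ltnW iP; have : nth set0 (enum P) i \in enum P by apply: mem_nth.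
    by rewrite mem_enum => /blockP /and4P[].
have [L0|L_gt0] := posnP #|L|.
  by apply: (IHk P L); rewrite ?L0.
have pick_block u v : u != v -> exists2 C : {set 'I_n}, C \in P &
    #|C| = K /\ h.*2 <= #|nbhd u :&: nbhd v :&: C|.
  move=> /common cL.
  have /card_gt0P[C] := leq_trans L_gt0 cL.
  by rewrite inE => /and3P[CP /eqP CK hC]; exists C.
have [L_gt1|L_le1] := ltnP 1 #|L|.
  have /card_gt1P[u [v [uL vL uv]]] := L_gt1.
  have [C CP [CK hC]] := pick_block u v uv.
  set W := nbhd u :&: nbhd v :&: C in hC.
  have sWC : W \subset C by apply: subsetIr.
  have [A sAW cA] : exists2 A : {set 'I_n}, A \subset W & #|A| = h.
    apply: exists_subset_card; apply: leq_trans hC.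
    by rewrite -addnn leq_addr.
  have [B sBW cB] : exists2 B : {set 'I_n}, B \subset W :\: A & #|B| = h.
    apply: exists_subset_card; rewrite cardsD (setIidPr sAW) cA.
    rewrite -(leq_add2l h) addnn subnKC // (leq_trans _ hC) //.
    by rewrite -addnn leq_addr.
  have AW x : x \in A -> [/\ x \in nbhd u, x \in nbhd v & x \in C].
    by move/(subsetP sAW); rewrite !in_setI => /andP[/andP[]].
  have BW x : x \in B ->
      [/\ x \notin A, x \in nbhd u, x \in nbhd v & x \in C].
    move/(subsetP sBW); rewrite !in_setD !in_setI.
    by case/andP=> xA /andP[/andP[]].
  have CL x : x \in C -> x \notin L.
    move=> xC; have : x \in cover P by apply/bigcupP; exists C.
    by rewrite (cover_partition partP) inE.
  have /and4P[cliqueC _ _ _] := blockP C CP.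
  have uC : u \notin C by apply: contraL uL; apply: CL.
  have vC : v \notin C by apply: contraL vL; apply: CL.
  have uA : u \notin A by apply: contraNN uC => /AW[].
  have vB : v \notin B by apply: contraNN vC => /BW[].
  have sAC : A \subset C by apply/subsetP => x /AW[].
  have sBC : B \subset C by apply/subsetP => x /BW[].
  have cAB : #|A :|: B| = h.*2.
    rewrite cardsU cA cB (_ : A :&: B = set0) ?cards0 ?subn0 ?addnn //.
    apply/setP => x; rewrite !inE; apply/negP => /andP[xA /BW[]].
    by rewrite xA.
  pose Z := C :\: (A :|: B).
  have cZ : #|Z| = K - h.*2.
    by rewrite cardsD (setIidPr _) ?subUset ?sAC // CK cAB.
  pose P' := (u |: A) |: ((v |: B) |: (Z |: P :\ C)).
  have partP' : partition P' (~: (L :\ u :\ v)).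
    (* These pointwise facts reduce the set identity and the disjointness claims below to
       truth-table checks. *)
    have facts x : [&& (x \in A) ==> (x \in C), (x \in B) ==> (x \in C),
        (x \in B) ==> (x \notin A), (x \in C) ==> (x \notin L),
        (x == u) ==> (x \in L) && (x != v) & (x == v) ==> (x \in L)].
      apply/and5P; split; try by apply/implyP => /AW[].
      - by apply/implyP => /BW[].
      - by apply/implyP => /BW[].
      - by apply/implyP => /CL.
      - by apply/andP; split; apply/implyP => /eqP-> //; rewrite uL.
    have -> : ~: (L :\ u :\ v) =
        (u |: A) :|: ((v |: B) :|: (Z :|: (~: L :\: C))).
      apply/setP => x; rewrite !inE; move: (facts x).
      by case: (x \in A); case: (x \in B); case: (x \in C); case: (x \in L);
        case: (x == u); case: (x == v).
    do 3?[apply: partitionU1].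
    - exact: partitionD1.
    - by rewrite -card_gt0 cZ.
    - rewrite disjoints_subset; apply/subsetP => x; rewrite !inE.
      by case: (x \in C); rewrite ?andbF.
    - by apply/set0Pn; exists v; rewrite setU11.
    - rewrite disjoints_subset; apply/subsetP => x; rewrite !inE.
      move: (facts x); case: (x \in A); case: (x \in B); case: (x \in C);
        by case: (x \in L); case: (x == u); case: (x == v).
    - by apply/set0Pn; exists u; rewrite setU11.
    - rewrite disjoints_subset; apply/subsetP => x; rewrite !inE.
      move: (facts x); case: (x \in A); case: (x \in B); case: (x \in C);
        by case: (x \in L); case: (x == u); case: (x == v).
  have cL : #|L| = #|L :\ u :\ v|.+2.
    by rewrite (cardsD1 u) uL (cardsD1 v) !inE eq_sym uv vL.
  apply: (IHk P' (L :\ u :\ v)) => //.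
  - by rewrite -ltnS (leq_trans _ Lk) // cL.
  - move=> V /setU1P[->|/setU1P[->|/setU1P[->|/setD1P[_ /blockP//]]]].
    + rewrite /even_block cardsU1 uA cA add1n /= odd_h leqnSn h_ltK andbT.
      apply: is_cliqueU1; first exact: is_cliqueS cliqueC.
      by apply/subsetP => x /AW[].
    + rewrite /even_block cardsU1 vB cB add1n /= odd_h leqnSn h_ltK andbT.
      apply: is_cliqueU1; first exact: is_cliqueS cliqueC.
      by apply/subsetP => x /BW[].
    + rewrite /even_block cZ le_h_Kh leq_subr even_Kh !andbT.
      by apply: is_cliqueS cliqueC; apply: subsetDl.
  (* Only [C] can disappear from the common blocks of [a] and [b]. *)
  - move=> a b ab; have := common a b ab; set G := common_blocks _ _ _ _ _.
    have : #|G :\ C| <= #|common_blocks h K P' a b|.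
      apply: subset_leq_card; apply/subsetP => D; rewrite !inE.
      by case/and4P=> DC -> -> ->; rewrite DC !orbT.
    rewrite (cardsD1 C G) cL => leGP' leLG; apply: leq_trans leGP'.
    rewrite -ltnS; apply: ltnW; apply: leq_trans leLG _.
    by rewrite -[in leqRHS]add1n leq_add2r leq_b1.
have /cards1P[w Lw] : #|L| == 1 by rewrite eqn_leq L_le1.
(* Common blocks are guaranteed for pairs only, so the last vertex is paired with an arbitrary other
   one; [1 < n] provides it. *)
have [w' ww'] : exists w', w != w'.
  have : 0 < #|[set: 'I_n] :\ w|.
    by have := cardsD1 w setT; rewrite cardsT card_ord inE => n_eq;
      rewrite -(ltn_add2l 1) -n_eq.
  by case/card_gt0P=> w'; rewrite !inE andbT eq_sym => ?; exists w'.
have [C CP [CK hC]] := pick_block w w' ww'.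
have [A sAW cA] := exists_subset_card _ _ _ hC.
have AW x : x \in A -> x \in nbhd w /\ x \in C.
  by move/(subsetP sAW); rewrite !in_setI => /andP[/andP[]].
have sAC : A \subset C by apply/subsetP => x /AW[].
have wC : w \notin C.
  apply/negP => wC; have : w \in cover P by apply/bigcupP; exists C.
  by rewrite (cover_partition partP) Lw !inE eqxx.
have wA : w \notin A by apply: contraNN wC; apply: subsetP.
have /and4P[cliqueC _ _ _] := blockP C CP.
have cZ : #|C :\: A| = K - h.*2 by rewrite cardsD (setIidPr sAC) CK cA.
pose P' := (C :\: A) |: P :\ C.
have partP' : partition P' (~: (w |: A)).
  have facts x : [&& (x \in A) ==> (x \in C) & (x == w) ==> (x \notin C)].
    by apply/andP; split; apply/implyP; [case/AW | move/eqP->].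
  have -> : ~: (w |: A) = (C :\: A) :|: (~: L :\: C).
    apply/setP => x; rewrite Lw !inE; move: (facts x).
    by case: (x \in A); case: (x \in C); case: (x == w).
  apply: partitionU1; first exact: partitionD1.
    by rewrite -card_gt0 cZ.
  rewrite disjoints_subset; apply/subsetP => x; rewrite !inE.
  by case: (x \in C); rewrite ?andbF.
have blockP' V : V \in P' -> even_block h K V.
  move=> /setU1P[->|/setD1P[_ /blockP//]].
  rewrite /even_block cZ le_h_Kh leq_subr even_Kh !andbT.
  by apply: is_cliqueS cliqueC; apply: subsetDl.
have wP' : w |: A \notin P'.
  apply/negP => wP'; have : w \in cover P'.
    by apply/bigcupP; exists (w |: A); rewrite ?setU11.
  by rewrite (cover_partition partP') !inE eqxx.
(* The block [w |: A] has odd size [h.*2.+1], so it is placed last, where parity is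
   unconstrained. *)
exists (rcons (enum P') (w |: A)); split.
- by rewrite rcons_uniq mem_enum wP' enum_uniq.
- have -> : [set X in rcons (enum P') (w |: A)] = (w |: A) |: P'.
    by apply/setP => X; rewrite !inE mem_rcons inE mem_enum !inE.
  rewrite -(setUCr (w |: A)); apply: partitionU1 => //.
    by apply/set0Pn; exists w; rewrite setU11.
  by rewrite disjoints_subset setCK.
- move=> V; rewrite mem_rcons inE mem_enum => /orP[/eqP->|/blockP' /and4P[]//].
  rewrite cardsU1 wA cA add1n; split=> //.
  apply: is_cliqueU1; first exact: is_cliqueS cliqueC.
  by apply/subsetP => x /AW[].
- move=> i; rewrite size_rcons ltnS => iP; rewrite nth_rcons iP.
  have : nth set0 (enum P') i \in enum P' by apply: mem_nth.
  by rewrite mem_enum => /blockP' /and4P[].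
Qed.

End Graphs.

(** Packing followed by absorption. The codegree hypothesis is that of [partition_average] with [m]
    bounding the size of the leftover set. *)
Lemma clique_partition (n : nat) (E : {set {set 'I_n}}) (h K m : nat) :
  (1 < n)%N -> odd h -> ~~ odd K -> (4 * h <= K)%N ->
  (forall S : {set 'I_n}, (m <= #|S|)%N ->
     exists2 Q : {set 'I_n}, Q \subset S & is_clique E Q /\ #|Q| = K) ->
  (forall u v, u != v ->
     (m * K.+1 * K + h.*2 * n < K * #|nbhd n E u :&: nbhd n E v|)%N) ->
  exists s : seq {set 'I_n},
    [/\ uniq s, partition [set X in s] [set: 'I_n],
        forall V, V \in s ->
          [/\ is_clique E V, (h <= #|V|)%N & (#|V| <= K)%N] &
        forall i, (i.+1 < size s)%N -> ~~ odd #|nth set0 s i|].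
Proof.
move=> n1 odd_h even_K hK cliques codeg.
have h0 := odd_gt0 odd_h; have K0 : (0 < K)%N by lia.
have [P [L [partP Lm cP]]] := clique_packing n E K m K0 cliques.
apply: (absorb_leftover n E h K n1 odd_h even_K hK #|L| P L) => //.
  move=> V /cP[clV VK]; rewrite /even_block clV VK even_K leqnn !andbT.
  by lia.
move=> u v /codeg big.
have -> : common_blocks n E h K P u v =
    [set C in P | (h.*2 <= #|nbhd n E u :&: nbhd n E v :&: C|)%N].
  by apply/setP => C; rewrite !inE; case: (boolP (C \in P)) => // /cP[_ ->];
    rewrite eqxx.
apply: (partition_average n K _ P L) => // [C /cP[]//|].
by apply: leq_ltn_trans big; rewrite leq_add2r !leq_mul // ltnW.
Qed.

Lemma natr_bin2 (R : realFieldType) (k : nat) :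
  'C(k, 2)%:R = k%:R * (k%:R - 1) / 2 :> R.
Proof.
elim: k => [|k IHk]; first by rewrite bin0n mul0r mul0r.
rewrite binS bin1 natrD IHk -[k.+1%:R]natr1; lra.
Qed.

(** * Two typical properties: edge density of large sets and large codegrees *)

Section TypicalGraphs.
Variables (R : realType) (n : nat) (p : R).
Hypotheses (p_ge0 : 0 <= p) (p_le1 : p <= 1).

(** The lower tail is applied to the singletons [[set e]], for [e] a pair inside [S]. *)
Lemma gnp_prob_sparse_set (S : {set 'I_n}) :
  gnp_prob p (fun E => #|edges_in n E S|%:R <= p * 'C(#|S|, 2)%:R / 4) <=
  expR (- (p * 'C(#|S|, 2)%:R / 4)).
Proof.
pose D := [set A : {set 'I_n} | A \subset S & #|A| == 2%N].
pose B := [set [set e] | e in D].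
have cB : #|B| = 'C(#|S|, 2) by rewrite card_imset ?cards_draws //; apply: set1_inj.
have := @gnp_lower_tail R n p p_ge0 p_le1 B 1; rewrite expr1 cB => tail.
apply: le_trans (tail _ _ _).
- apply: le_gnp_prob => // E; apply: le_trans; rewrite ler_nat.
  have -> : [set b in B | b \subset E] = [set [set e] | e in edges_in n E S].
    apply/setP => b; rewrite inE; apply/andP/imsetP => [[/imsetP[e eD ->]]|[e]].
      rewrite sub1set => eE; exists e => //; rewrite inE eE.
      by move: eD; rewrite inE.
    rewrite inE => /andP[eE eS] ->; rewrite sub1set eE; split=> //.
    by apply: imset_f; rewrite inE.
  by rewrite card_imset //; apply: set1_inj.
- apply/trivIsetP => _ _ /imsetP[e _ ->] /imsetP[f _ ->] ef.
  by rewrite disjoints1 inE; apply: contraNN ef => /eqP->.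
- by move=> _ /imsetP[e + ->]; rewrite sub1set !inE => /andP[].
- by move=> _ /imsetP[e _ ->]; rewrite cards1.
Qed.

(** The lower tail is applied to the paths of length two from [u] to [v], which are pairwise
    edge-disjoint because an edge determines its middle vertex. *)
Lemma gnp_prob_low_codegree (u v : 'I_n) : u != v ->
  gnp_prob p
    (fun E => #|nbhd n E u :&: nbhd n E v|%:R <= p ^+ 2 * (n - 2)%N%:R / 4) <=
  expR (- (p ^+ 2 * (n - 2)%N%:R / 4)).
Proof.
move=> uv; pose D := ~: [set u; v].
pose cherry w := [set [set u; w]; [set v; w]].
pose B := [set cherry w | w in D].
have DP w : w \in D -> w != u /\ w != v.
  by rewrite !inE negb_or => /andP[].
have meet w w' e : w \in D -> e \in cherry w -> e \in cherry w' -> w = w'.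
  move=> /DP[/negbTE wu /negbTE wv] ew.
  have we : w \in e by case/set2P: ew => ->; rewrite !inE eqxx orbT.
  by case/set2P=> e_eq; move: we; rewrite e_eq !inE ?wu ?wv /= => /eqP.
have inj : {in D &, injective cherry}.
  move=> w w' wD _ eq_ww'; apply: (meet w w' [set u; w]) => //.
    by rewrite !inE eqxx.
  by rewrite -eq_ww' !inE eqxx.
have cB : #|B| = (n - 2)%N.
  by rewrite card_in_imset // cardsCs setCK cards2 uv card_ord.
have := @gnp_lower_tail R n p p_ge0 p_le1 B 2; rewrite cB => tail.
apply: le_trans (tail _ _ _).
- apply: le_gnp_prob => // E; apply: le_trans; rewrite ler_nat.
  have sub : [set b in B | b \subset E] \subset
      [set cherry w | w in nbhd n E u :&: nbhd n E v].
    apply/subsetP => b; rewrite inE => /andP[/imsetP[w /DP[wu wv] ->]].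
    rewrite subUset !sub1set => /andP[uwE vwE].
    by apply: imset_f; rewrite !inE wu wv uwE vwE.
  by apply: leq_trans (subset_leq_card sub) _; apply: leq_imset_card.
- apply/trivIsetP => _ _ /imsetP[w wD ->] /imsetP[w' _ ->] ww'.
  rewrite disjoints_subset; apply/subsetP => e ew; rewrite inE.
  by apply: contraNN ww' => ew'; rewrite (meet w w' e).
- move=> _ /imsetP[w /DP[wu wv] ->]; rewrite subUset !sub1set !inE.
  by rewrite !cards2 (eq_sym u) wu (eq_sym v) wv.
- move=> _ /imsetP[w /DP[wu wv] ->]; rewrite cards2; case: eqP => // /setP/(_ u).
  by rewrite !inE eqxx (negbTE uv) (eq_sym u) (negbTE wu).
Qed.

Definition sparse (s : R) (E : {set {set 'I_n}}) : bool :=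
  [exists S in [pred S : {set 'I_n} | s <= #|S|%:R],
     #|edges_in n E S|%:R <= p * 'C(#|S|, 2)%:R / 4].

Definition low_codegree (E : {set {set 'I_n}}) : bool :=
  [exists uv in [pred uv : 'I_n * 'I_n | uv.1 != uv.2],
     #|nbhd n E uv.1 :&: nbhd n E uv.2|%:R <= p ^+ 2 * (n - 2)%N%:R / 4].

(** Union bound over all 2^n <= exp(n) vertex sets; [1 <= s] makes t(t - 1) monotone for t >= s. *)
Lemma gnp_prob_sparse (s : R) : 1 <= s ->
  gnp_prob p (sparse s) <= expR (n%:R - p * s * (s - 1) / 8).
Proof.
move=> s1; apply: le_trans (@gnp_prob_exists _ _ _ p_ge0 p_le1 _ _ _) _.
rewrite expRD.
apply: (@le_trans _ _ (\sum_(S : {set 'I_n}) expR (- (p * s * (s - 1) / 8)))).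
  rewrite big_mkcond /=; apply: ler_sum => S _; case: ifPn => [sS|_].
    apply: le_trans (gnp_prob_sparse_set S) _.
    rewrite ler_expR lerN2 natr_bin2.
    rewrite inE in sS.
    suff : p * (s * (s - 1)) <= p * (#|S|%:R * (#|S|%:R - 1)) by lra.
    rewrite ler_wpM2l // ler_pM //; lra.
  exact: expR_ge0.
rewrite sumr_const -[leLHS]mulr_natl ler_pM2r ?expR_gt0 //.
rewrite -cardsT -powersetT card_powerset cardsT card_ord natrX.
rewrite -[n%:R]mulr1 expRM_natl lerXn2r ?nnegrE ?expR_ge0 //.
by have := expR_ge1Dx (1 : R); lra.
Qed.

Lemma gnp_prob_low_codegrees :
  gnp_prob p low_codegree <= n%:R ^+ 2 * expR (- (p ^+ 2 * (n - 2)%N%:R / 4)).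
Proof.
apply: le_trans (@gnp_prob_exists _ _ _ p_ge0 p_le1 _ _ _) _.
apply: (@le_trans _ _ (\sum_(uv : 'I_n * 'I_n)
    expR (- (p ^+ 2 * (n - 2)%N%:R / 4)))).
  rewrite big_mkcond /=; apply: ler_sum => uv _; case: ifPn => [|_].
    by rewrite inE => /gnp_prob_low_codegree.
  exact: expR_ge0.
by rewrite sumr_const card_prod card_ord -[leLHS]mulr_natl natrM expr2.
Qed.

(** If all degrees inside [S] were below p|S|/16, then [S] would span at most p|S|^2/16 <= p|S|(|S|
    - 1)/8 edges, using |S| >= 2. That is exactly the excluded density. *)
Lemma dense_vertex (s : R) (E : {set {set 'I_n}}) :
  0 < p -> 2 <= s -> ~~ sparse s E ->
  forall S : {set 'I_n}, s <= #|S|%:R ->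
  exists2 v, v \in S & p / 16 * #|S|%:R <= #|nbhd n E v :&: S|%:R.
Proof.
move=> p_gt0 s2 /exists_inPn dense S sS.
have := dense S sS; rewrite -ltNge natr_bin2 => edges.
apply/exists_inP; apply: contraLR edges => /exists_inPn low; rewrite -leNgt.
have S2 : 2 <= #|S|%:R :> R by lra.
have : #|edges_in n E S|%:R <= #|S|%:R * (p / 16 * #|S|%:R) :> R.
  apply: (@le_trans _ _ (\sum_(v in S) #|nbhd n E v :&: S|)%N%:R).
    by rewrite ler_nat card_edges_in_le.
  rewrite natr_sum mulr_natl -sumr_const; apply: ler_sum => v /low.
  by rewrite -ltNge => /ltW.
move=> /le_trans; apply.
set t : R := #|S|%:R in S2 *.
suff : p * (t * t) <= p * (2 * (t * (t - 1))) by lra.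
rewrite ler_pM2l //; nra.
Qed.

End TypicalGraphs.

(** * Choice of parameters and asymptotic estimates *)

Section Asymptotics.
Variables (R : realType) (p : R).
Hypotheses (p_gt0 : 0 < p) (p_le1 : p <= 1).

(** A lower bound for x = (ln n)^(1/3). The logarithmic part makes x^3/4 beat the linear losses in
    [leftover_bound]; the term [64 / p ^+ 2] absorbs rounding in the choice of [h]. *)
Definition threshold : R :=
  4 * (2 * - ln (p / 16) + 2 - ln (p ^+ 2 / 32)) + 64 / p ^+ 2.

(** This is n^(3/4) when n = exp(x^3). *)
Definition dense_size (x : R) : R := expR (3 / 4 * x ^+ 3).

Lemma p_bounds : [/\ 0 < p, p <= 1, 0 < p ^+ 2 & p ^+ 2 <= 1].
Proof. by split; rewrite ?exprn_gt0 // exprn_ile1 // ltW. Qed.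

Lemma ln_bounds : 0 <= - ln (p / 16) /\ 0 <= - ln (p ^+ 2 / 32).
Proof.
have [p0 p1 q0 q1] := p_bounds; split; rewrite oppr_ge0; apply: ln_le0; lra.
Qed.

Lemma threshold_ge x : threshold <= x ->
  [/\ 64 <= x, 64 <= p ^+ 2 * x, 4 * - ln (p / 16) + 8 <= x &
      4 * (2 * - ln (p / 16) + 2 - ln (p ^+ 2 / 32)) < x].
Proof.
have [p0 p1 q0 q1] := p_bounds; have [a0 b0] := ln_bounds; rewrite /threshold => tx.
have iq : 64 <= 64 / p ^+ 2 by rewrite ler_pdivlMr //; lra.
split; try lra.
rewrite -ler_pdivrMl // mulrC; lra.
Qed.

Lemma nat_between (y : R) : 0 <= y -> exists m : nat, y <= m%:R /\ m%:R <= y + 1.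
Proof.
move=> y0; have /andP[] := truncn_itv y0; set t := Num.truncn y => t1 t2.
by exists t.+1; move: t2; rewrite -[t.+1%:R]natr1 => t2; split; lra.
Qed.

Lemma even_nat_between (y : R) : 1 <= y ->
  exists2 K : nat, ~~ odd K & y <= K%:R /\ K%:R <= 2 * y.
Proof.
move=> y1; have /andP[] := @truncn_itv R y ltac:(lra).
have : (0 < Num.truncn y)%N by rewrite truncn_gt0.
set t := Num.truncn y; rewrite -[t.+1%:R]natr1 -(ler_nat R) => t0 t1 t2.
exists t.*2; first by rewrite odd_double.
by rewrite -muln2 natrM; split; lra.
Qed.

Lemma odd_nat_between (y : R) : 0 <= y ->
  exists2 h : nat, odd h & y <= h%:R /\ h%:R <= 2 * y + 1.
Proof.
move=> y0; have /andP[] := truncn_itv y0; set t := Num.truncn y.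
rewrite -[t.+1%:R]natr1 => t1 t2; have t0 := ler0n R t.
exists t.*2.+1; first by rewrite /= odd_double.
by rewrite -[t.*2.+1%:R]natr1 -muln2 natrM; split; lra.
Qed.

Lemma cube_ge (x : R) : 2 <= x -> 2 * x ^+ 2 <= x ^+ 3 /\ 2 * x <= x ^+ 2.
Proof. by rewrite !exprS expr0 => x2; split; nra. Qed.

(** Bounds the leftover term of the codegree condition. With A, B the two negated logarithms, the
    exponents compare because 2Ax + 2x + B <= (2A + 2 + B)x, which is at most x^2/4 and so below
    x^3/4. *)
Lemma leftover_bound x (K : nat) : threshold <= x -> K%:R <= 2 * x ->
  (dense_size x / (p / 16) ^+ K + 1) * (K%:R + 1) < p ^+ 2 / 16 * expR (x ^+ 3).
Proof.
move=> tx Kx; have [x64 _ _ xAB] := threshold_ge x tx.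
have [A0 B0] := ln_bounds; have [p0 p1 q0 q1] := p_bounds.
set A := - ln (p / 16) in A0 xAB *; set B := - ln (p ^+ 2 / 32) in B0 xAB *.
have a_gt0 : 0 < p / 16 by lra.
have -> : p ^+ 2 / 16 = 2 * expR (- B).
  by rewrite opprK lnK ?posrE; lra.
have -> : (p / 16) ^+ K = expR (- (A * K%:R)).
  by rewrite -mulNr opprK expRM_natr lnK.
rewrite -expRN opprK -expRD.
have [x3 x2] : 2 * x ^+ 2 <= x ^+ 3 /\ 2 * x <= x ^+ 2 by apply: cube_ge; lra.
set y := 3 / 4 * x ^+ 3 + A * (2 * x).
have y_le : expR (3 / 4 * x ^+ 3 + A * K%:R) + 1 <= 2 * expR y.
  have : expR (3 / 4 * x ^+ 3 + A * K%:R) <= expR y.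
    by rewrite ler_expR /y lerD2l ler_wpM2l.
  have : 1 <= expR y by rewrite -expR0 ler_expR /y addr_ge0 ?mulr_ge0 //; lra.
  by lra.
have K_le : K%:R + 1 <= expR (2 * x).
  by apply: le_trans (expR_ge1Dx _); lra.
apply: (@le_lt_trans _ _ (2 * expR y * expR (2 * x))).
  by rewrite ler_pM // addr_ge0 // expR_ge0.
rewrite -!mulrA ltr_pM2l // -!expRD ltr_expR /y.
have : (2 * A + 2 + B) * 4 * x <= x ^+ 2.
  by rewrite expr2 ler_wpM2r //; lra.
nra.
Qed.

(** The square of [dense_size x] is n^(3/2), so the exponent in [gnp_prob_sparse] is at most -n. *)
Lemma sparse_bound x : threshold <= x ->
  2 * expR (x ^+ 3) <= p * dense_size x * (dense_size x - 1) / 8.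
Proof.
have [p0 p1 q0 q1] := p_bounds.
move=> tx; have [x64 _ xA _] := threshold_ge x tx.
have [x3 x2] : 2 * x ^+ 2 <= x ^+ 3 /\ 2 * x <= x ^+ 2 by apply: cube_ge; lra.
have d2 : 2 <= dense_size x by apply: le_trans (expR_ge1Dx _); lra.
apply: (@le_trans _ _ (p / 16 * (dense_size x * dense_size x))); last first.
  suff : p * (dense_size x * dense_size x) <=
         p * (2 * (dense_size x * (dense_size x - 1))) by lra.
  rewrite ler_pM2l //; nra.
rewrite -expRD -[p / 16]lnK ?posrE; last by lra.
rewrite -expRD.
have e2 : 2 <= expR 1 :> R by have := expR_ge1Dx (1 : R); lra.
apply: (@le_trans _ _ (expR 1 * expR (x ^+ 3))).
  by rewrite ler_wpM2r ?expR_ge0.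
by rewrite -expRD ler_expR; lra.
Qed.

Lemma typical_good_partition (n : nat) (E : {set {set 'I_n}}) :
  let x := ln (n%:R : R) `^ 3^-1 in
  (3 < n)%N -> threshold <= x ->
  ~~ sparse R n p (dense_size x) E -> ~~ low_codegree R n p E ->
  good_partition (p ^+ 2 / 128) 2 E.
Proof.
move=> x n3 tx dense codeg.
have [x64 qx _ _] := threshold_ge x tx; have [p0 p1 q0 q1] := p_bounds.
have nE : n%:R = expR (x ^+ 3) :> R.
  rewrite /x -powR_mulrn ?powR_ge0 // -powRrM mulVf ?pnatr_eq0 // powRr1 ?lnK ?posrE //.
    by rewrite ltr0n (leq_trans _ n3).
  by rewrite ln_ge0 // ler1n (leq_trans _ n3).
have [K even_K [K_ge K_le]] := even_nat_between x ltac:(lra).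
have qK : p ^+ 2 * x <= p ^+ 2 * K%:R by rewrite ler_pM2l.
(* The lower bound on [h] yields the constant [p ^+ 2 / 128], since K >= x. The upper bound yields
   4h <= K and, as p^2 K >= 64, also 2h <= p^2 K/16. *)
have [h odd_h [h_ge h_le]] := odd_nat_between (p ^+ 2 * K%:R / 128) ltac:(lra).
(* A set of size [r] can lose a factor [p / 16] in each of [K] steps and still have [dense_size x]
   vertices. *)
pose r := dense_size x / (p / 16) ^+ K.
have aK : 0 < (p / 16) ^+ K by rewrite exprn_gt0 //; lra.
have r0 : 0 <= r by rewrite divr_ge0 ?expR_ge0 // ltW.
have [m [m_ge m_le]] := nat_between r r0.
have KqK : p ^+ 2 * K%:R <= K%:R by rewrite ler_piMl.
have d2 : 2 <= dense_size x.
  have [x3 x2] : 2 * x ^+ 2 <= x ^+ 3 /\ 2 * x <= x ^+ 2 by apply: cube_ge; lra.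
  by apply: le_trans (expR_ge1Dx _); lra.
have [||||||s [us ps cs os]] := clique_partition n E h K m.
- exact: leq_trans n3.
- exact: odd_h.
- exact: even_K.
- by rewrite -(ler_nat R) natrM; lra.
- move=> S mS; apply: (@clique_of_dense n E R (p / 16) (dense_size x)).
  + by lra.
  + by lra.
  + exact: dense_vertex.
  + rewrite mulrC -ler_pdivrMr //; apply: le_trans m_ge _.
    by rewrite ler_nat.
- move=> u v uv; rewrite -(ltr_nat R) natrD !natrM.
  have /exists_inPn/(_ (u, v) uv) := codeg; rewrite -ltNge /=.
  set c : R := #|_|%:R => cE.
  have left := leftover_bound x K tx K_le; rewrite -/r in left.
  have mK : m%:R * K.+1%:R <= p ^+ 2 / 16 * n%:R.
    rewrite nE; apply: le_trans (ltW left); rewrite -natr1.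
    by rewrite ler_pM ?ler0n // addr_ge0.
  have n2 : n%:R / 2 <= (n - 2)%N%:R :> R.
    rewrite natrB; last exact: leq_trans n3.
    have : 4 <= n%:R :> R by rewrite ler_nat.
    by lra.
  have qn : p ^+ 2 * (n%:R / 2) <= p ^+ 2 * (n - 2)%N%:R by rewrite ler_pM2l.
  have K0 : 0 < K%:R :> R by lra.
  have hn : h.*2%:R * n%:R <= p ^+ 2 / 16 * n%:R * K%:R.
    rewrite -mulrAC ler_wpM2r ?ler0n // -muln2 natrM; lra.
  (* Each of the two terms takes half of this budget, and codegrees exceed p^2(n - 2)/4 >= p^2
     n/8. *)
  apply: (@le_lt_trans _ _ (p ^+ 2 / 8 * n%:R * K%:R)).
    have : m%:R * K.+1%:R * K%:R <= p ^+ 2 / 16 * n%:R * K%:R.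
      by rewrite ler_pM2r.
    by lra.
  rewrite mulrC ltr_pM2l //; lra.
exists s; split=> // V /cs[] //.
move=> _ hV VK; split.
  apply: (@le_trans _ _ h%:R); last by rewrite ler_nat.
  by rewrite -/x; lra.
by apply: (@le_trans _ _ K%:R); rewrite ?ler_nat.
Qed.

(** With t = p^2 n/8, the bound exp(t) >= t^3/6 leaves 3072/(p^6 n), and 1/n <= 2/(n + 1) puts it in
    terms of the harmonic sequence. *)
Lemma codegree_tail_bound (n : nat) : (3 < n)%N ->
  n%:R ^+ 2 * expR (- (p ^+ 2 * (n - 2)%N%:R / 4)) <=
  6144 / p ^+ 6 * n.+1%:R^-1.
Proof.
have [p0 p1 q0 q1] := p_bounds; move=> n3.
have n4 : 4 <= n%:R :> R by rewrite ler_nat.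
have n0 : 0 < n%:R :> R by apply: lt_le_trans n4.
have n2 : p ^+ 2 * (n%:R / 2) <= p ^+ 2 * (n - 2)%N%:R.
  rewrite ler_pM2l // natrB; last exact: leq_trans n3.
  by move: n4; lra.
pose t := p ^+ 2 * n%:R / 8.
have t0 : 0 < t by rewrite divr_gt0 ?mulr_gt0.
apply: (@le_trans _ _ (n%:R ^+ 2 * (6 / t ^+ 3))).
  rewrite ler_wpM2l ?exprn_ge0 ?ler0n //.
  apply: (@le_trans _ _ (expR (- t))).
    by rewrite ler_expR /t; move: n2; lra.
  rewrite expRN -[6 / _]invf_div lef_pV2 ?posrE ?expR_gt0 //; last first.
    by rewrite divr_gt0 ?exprn_gt0.
  have := @expR_ge1Dxn R t 2 (ltW t0).
  by rewrite (_ : (3`!)%:R = 6) //; lra.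
have -> : n%:R ^+ 2 * (6 / t ^+ 3) = 3072 / p ^+ 6 * n%:R^-1 :> R.
  rewrite /t; field.
  by rewrite !gt_eqF.
have -> : 6144 / p ^+ 6 = 3072 / p ^+ 6 * 2 by lra.
have c0 : 0 <= 3072 / p ^+ 6 by rewrite divr_ge0 // exprn_ge0 // ltW.
rewrite -[leRHS]mulrA; apply: ler_wpM2l => //.
rewrite -[leRHS]invf_div lef_pV2 ?posrE ?divr_gt0 ?ltr0Sn //.
by rewrite -[n.+1%:R]natr1; move: n4; lra.
Qed.

(** [good_partition] is a proposition, so a boolean [P] implied by it stands in for the event. The
    sparse event contributes at most exp(-n) <= 1/(n + 1). *)
Lemma gnp_prob_ge (n : nat) (P : pred {set {set 'I_n}}) :
  (3 < n)%N -> threshold <= ln (n%:R : R) `^ 3^-1 ->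
  (forall E, good_partition (p ^+ 2 / 128) 2 E -> P E) ->
  1 - (1 + 6144 / p ^+ 6) * n.+1%:R^-1 <= gnp_prob p P.
Proof.
have [p0 p1 q0 q1] := p_bounds; set x := _ `^ _ => n3 tx goodP.
have p_ge0 := ltW p0; rewrite gnp_probC // lerD2l lerN2.
apply: (@le_trans _ _ (gnp_prob p
    (fun E => sparse R n p (dense_size x) E || low_codegree R n p E))).
  apply: le_gnp_prob => // E; apply: contraNT; rewrite negb_or => /andP[sp lc].
  by apply: goodP; apply: typical_good_partition.
apply: le_trans (gnp_prob_or _ _ _ p_ge0 p1 _ _) _; rewrite mulrDl mul1r.
apply: lerD; last first.
  apply: le_trans (gnp_prob_low_codegrees _ _ _ p_ge0 p1) _.
  exact: codegree_tail_bound.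
have [x64 _ _ _] := threshold_ge x tx.
have s1 : 1 <= dense_size x.
  by rewrite -[leLHS]expR0 ler_expR mulr_ge0 // ?exprn_ge0 //; lra.
apply: le_trans (gnp_prob_sparse _ _ _ p_ge0 p1 _ s1) _.
have nE : n%:R = expR (x ^+ 3) :> R.
  rewrite /x -powR_mulrn ?powR_ge0 // -powRrM mulVf ?pnatr_eq0 // powRr1.
    by rewrite lnK // posrE ltr0n (leq_trans _ n3).
  by rewrite ln_ge0 // ler1n (leq_trans _ n3).
apply: (@le_trans _ _ (expR (- n%:R))).
  by rewrite ler_expR; have := sparse_bound x tx; rewrite -nE; lra.
rewrite expRN lef_pV2 ?posrE ?expR_gt0 ?ltr0n //.
by rewrite -natr1 addrC expR_ge1Dx.
Qed.

Lemma threshold_eventually :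
  exists N : nat, forall n, (N <= n)%N -> threshold <= ln (n%:R : R) `^ 3^-1.
Proof.
have [p0 p1 q0 q1] := p_bounds; have [A0 B0] := ln_bounds.
have t0 : 0 <= threshold.
  by rewrite addr_ge0 ?mulr_ge0 ?invr_ge0 ?(ltW q0) //; lra.
exists (Num.truncn (expR (threshold ^+ 3))).+1 => n nN.
have en : expR (threshold ^+ 3) <= n%:R.
  have /andP[_ /ltW] := truncn_itv (expR_ge0 (threshold ^+ 3)).
  by move/le_trans; apply; rewrite ler_nat.
have ln_n : threshold ^+ 3 <= ln (n%:R : R).
  by rewrite -[leLHS]expRK ler_ln ?posrE ?expR_gt0 // (lt_le_trans _ en) ?expR_gt0.
have {1}<- : (threshold ^+ 3) `^ 3^-1 = threshold.
  by rewrite -powR_mulrn // -powRrM mulfV ?pnatr_eq0 // powRr1.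
have t3 : 0 <= threshold ^+ 3 by rewrite exprn_ge0.
by apply: ge0_ler_powR; rewrite ?nnegrE ?invr_ge0 // (le_trans t3).
Qed.

End Asymptotics.

(* Imported only here: these libraries shadow the names of finset. *)
From mathcomp Require Import all_classical all_reals all_analysis.
Import numFieldNormedType.Exports.
Local Open Scope classical_set_scope.

Theorem theorem2p1 (R : realType) (p : R) :
  0 < p -> p <= 1 ->
  exists c1 c2 : R, 0 < c1 /\ 0 < c2 /\
    ((fun n : nat => gnp_prob (n := n) p (fun E => `[< good_partition c1 c2 E >])) : R^nat)
      @ \oo --> (1 : R).
Proof.
move=> p0 p1; exists (p ^+ 2 / 128), 2.
split; first by rewrite divr_gt0 ?exprn_gt0.
split=> //.
pose c := 1 + 6144 / p ^+ 6.
have [N thN] := threshold_eventually R p p0 p1.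
(* Squeeze between 1 - c/(n + 1) and 1; the lower bound holds only for large [n]. *)
apply: (@squeeze_cvgr _ _ _ _ (fun n => 1 - c * n.+1%:R^-1) (fun=> 1)).
- near=> n; apply/andP; split.
    apply: gnp_prob_ge => //.
    + by near: n; exact: nbhs_infty_gt.
    + by apply: thN; near: n; exact: nbhs_infty_ge.
    + by move=> E gE; apply/asboolP.
  rewrite -(@gnp_prob_predT R n p); apply: le_gnp_prob => //; exact: ltW.
- rewrite -[X in _ --> X]subr0; apply: cvgB; first exact: cvg_cst.
  rewrite -(mulr0 c); apply: cvgM; first exact: cvg_cst.
  exact: cvg_harmonic.
- exact: cvg_cst.
Unshelve. all: by end_near.
Qed.
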